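(* Let $\boldsymbol\beta_2=(\beta_0,\beta_1,\beta_2)$ with $\beta_k\ge0$, let $\mathbf{W}=(W,\mathbb{W})\in\mathbf{C}^{\alpha,\boldsymbol\beta_2}([0,T]\times V;V)$ be a nonlinear rough path, let $(Y,\dot Y)\in\mathcal{E}^{2\alpha}_W$, and let $Z:[0,T]\to V$ be the nonlinear rough integral $$Z_t=\int_0^tW(dr,Y_r).$$ Then $Z$ is controlled by $W$ with Gubinelli derivative $Y$: $(Z,\dot Z)=(Z,Y)\in\mathcal{E}^{2\alpha}_W$.
   Context: Fix $T>0$, $\alpha\in(\frac13,\frac12]$ and a separable Banach space $V$. For a function $\Phi$ of time, $\Phi_{s,t}:=\Phi_t-\Phi_s$ (for $W(t,x)$: $W_{s,t}(x)=W(t,x)-W(s,x)$). $\mathcal{C}^\alpha([0,T];V)$ is the space of $Y:[0,T]\to V$ with $\|Y\|_\alpha=\sup_{s\ne t}\|Y_{s,t}\|_V/|t-s|^\alpha<\infty$; $\mathcal{C}_2^{2\alpha}([0,T]^2;V)$ is the space of $R:[0,T]^2\to V$ with $\sup_{s\ne t}\|R_{s,t}\|_V/|t-s|^{2\alpha}<\infty$. For $\boldsymbol\beta_n=(\beta_0,\dots,\beta_n)$ with $\beta_k\ge0$, $\mathcal{C}^{\alpha,\boldsymbol\beta_n}([0,T]\times V;V)$ is the space of functions $\Phi$, $n$ times continuously Fréchet differentiable in space, with $$\|\Phi\|_{\alpha,\boldsymbol\beta_n}=\sum_{k=0}^n\sup_{s\ne t,\,x\in V}\frac{\|D^k\Phi_{s,t}(x)\|}{|t-s|^\alpha(1+\|x\|_V)^{\beta_k}}<\infty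 .$$ For multi-indices $\boldsymbol\beta^1,\boldsymbol\beta^2$ of length $m+1$ and $\gamma>0$, $\mathcal{C}_2^{\gamma,\boldsymbol\beta^1,\boldsymbol\beta^2}([0,T]^2\times V^2;V)$ is the space of $\Psi$, $m$ times continuously Fréchet differentiable in $(x_1,x_2)\in V^2$ (normed by $\|x_1\|_V+\|x_2\|_V$), with $$\|\Psi\|_{\gamma,\boldsymbol\beta^1,\boldsymbol\beta^2}=\sum_{k=0}^m\sup_{s\ne t,\,(x_1,x_2)\in V^2}\frac{\|D^k\Psi_{s,t}(x_1,x_2)\|}{|t-s|^\gamma(1+\|x_1\|_V)^{\beta^1_k}(1+\|x_2\|_V)^{\beta^2_k}}<\infty .$$ Given $\boldsymbol\beta_n$, $n\ge1$, set $\beta^*_k=\max\{\beta_0,\dots,\beta_k\}$, $\beta^{**}_k=\max\{\beta_1,\dots,\beta_{k+1}\}$ for $0\le k\le n-1$, $\boldsymbol\beta^*_{n-1}=(\beta^*_0,\dots,\beta^*_{n-1})$, $\boldsymbol\beta^{**}_{n-1}=(\beta^{**}_0,\dots,\beta^{**}_{n-1})$. A nonlinear rough path $\mathbf{W}=(W,\mathbb{W})\in\mathbf{C}^{\alpha,\boldsymbol\beta_n}([0,T]\times V;V)$ is a pair with $W\in\mathcal{C}^{\alpha,\boldsymbol\beta_n}([0,T]\times V;V)$, $\mathbb{W}\in\mathcal{C}_2^{2\alpha,\boldsymbol\beta^*_{n-1},\boldsymbol\beta^{**}_{n-1}}([0,T]^2\times V^2;V)$, satisfying Chen's relation $\mathbb{W}_{s,t}(x,y)-\mathbb{W}_{s,u}(x,y)-\mathbb{W}_{u,t}(x,y)=DW_{u,t}(y)(W_{s,u}(x))$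 for all $x,y\in V$, $s,u,t\in[0,T]$. $\mathcal{E}_W^{2\alpha}$ is the set of pairs $(Y,\dot Y)\in\mathcal{C}^\alpha([0,T];V)^2$ such that $R^Y_{s,t}:=Y_{s,t}-W_{s,t}(\dot Y_s)$ belongs to $\mathcal{C}_2^{2\alpha}([0,T]^2;V)$; $\dot Y$ is called the Gubinelli derivative. For $(Y,\dot Y)\in\mathcal{E}^{2\alpha}_W$ the nonlinear rough integral is $$\int_s^tW(dr,Y_r):=\lim_{|\pi|\to0}\sum_{k=1}^n\big[W_{t_{k-1},t_k}(Y_{t_{k-1}})+\mathbb{W}_{t_{k-1},t_k}(\dot Y_{t_{k-1}},Y_{t_{k-1}})\big],$$ the limit being over partitions $\pi=(s=t_0<\dots<t_n=t)$ of mesh $|\pi|\to0$ (it exists and is additive in the interval). *)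

(* Defs.v *)
From HB Require Import structures.
From mathcomp Require Import all_boot all_order all_algebra.
From mathcomp Require Import all_classical all_reals all_analysis.

Set Implicit Arguments.
Unset Strict Implicit.
Unset Printing Implicit Defensive.

Import Order.TTheory GRing.Theory Num.Theory.
Import numFieldNormedType.Exports.

Local Open Scope classical_set_scope.
Local Open Scope ring_scope.

Definition separable_space (X : topologicalType) : Prop :=
  exists2 D : set X, countable D & dense D.

(** The normed space of continuous linear maps with the operator norm, so that
    the derivatives [D^k f] take values in genuine normed modules. *)
Section BoundedLinear.
Context {R : realType} (U F : normedModType R).

Definition blin_pred : {pred U -> F} :=
  mem [set f : U -> F | linear f /\ continuous f].

Lemma blin_predP (f : U -> F) :
  reflect (linear f /\ continuous f) (f \in blin_pred).
Proof. by apply: (iffP idP) => [/set_mem//|?]; apply/mem_set. Qed.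

Lemma blin_submod_closed : submod_closed blin_pred.
Proof.
split.
  apply/blin_predP; split; last exact: cst_continuous.
  by move=> a u v /=; rewrite scaler0 addr0.
move=> a f g /blin_predP[lf cf] /blin_predP[lg cg].
apply/blin_predP; split.
  move=> b u v; rewrite -[LHS]/(a *: f (b *: u + v) + g (b *: u + v)).
  rewrite -[RHS]/(b *: (a *: f u + g u) + (a *: f v + g v)).
  rewrite lf lg !scalerDr !scalerA mulrC -!addrA.
  by congr (_ + _); rewrite addrCA.
move=> x; apply: (@cvgD _ _ _ _ _ (fun y => a *: f y) g).
  by apply: cvgZr; exact: cf.
exact: cg.
Qed.

HB.instance Definition _ := GRing.isSubmodClosed.Build R (U -> F)
  blin_pred blin_submod_closed.

Record blin := BLin { blin_fun :> U -> F ; _ : blin_fun \in blin_pred }.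

HB.instance Definition _ := [isSub for blin_fun].
HB.instance Definition _ := [Choice of blin by <:].
HB.instance Definition _ := [SubChoice_isSubLmodule of blin by <:].

Lemma blin_linear (f : blin) : linear f.
Proof. by case: f => f /= /blin_predP[]. Qed.

HB.instance Definition _ (f : blin) :=
  GRing.isLinear.Build R U F *:%R (blin_fun f) (blin_linear f).

Lemma blin_continuous (f : blin) : continuous f.
Proof. by case: f => f /= /blin_predP[]. Qed.

Definition opnorm (f : blin) : R := sup [set `|f x| | x in [set x | `|x| <= 1]].

Lemma opnorm_has_sup (f : blin) :
  has_sup [set `|f x| | x in [set x | `|x| <= 1]].
Proof.
split; first by exists `|f 0|, 0 => //=; rewrite normr0.
have := @continuous_linear_bounded _ _ _ 0 (f : {linear U -> F})
  (@blin_continuous f 0).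
move=> /bounded_funP /(_ 1) [M fM].
by exists M => _ [x /= x1 <-]; exact: fM.
Qed.

Lemma opnorm_ge0 (f : blin) : 0 <= opnorm f.
Proof.
apply: (le_trans (normr_ge0 (f 0))).
apply: sup_upper_bound; first exact: opnorm_has_sup.
by exists 0 => //=; rewrite normr0.
Qed.

Lemma opnormP (f : blin) (x : U) : `|f x| <= opnorm f * `|x|.
Proof.
have [->|x0] := eqVneq x 0; first by rewrite linear0 !normr0 mulr0.
rewrite -ler_pdivrMr ?normr_gt0//.
apply: sup_upper_bound; first exact: opnorm_has_sup.
exists (`|x|^-1 *: x) => /=.
  by rewrite normrZ normfV normr_id mulVf// normr_eq0.
by rewrite linearZ/= normrZ normfV normr_id mulrC.
Qed.

Lemma opnorm_le (f : blin) (M : R) :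
  0 <= M -> (forall x, `|f x| <= M * `|x|) -> opnorm f <= M.
Proof.
move=> M0 fM; apply: ge_sup; first by case: (opnorm_has_sup f).
by move=> _ [x /= x1 <-]; rewrite (le_trans (fM x))// ler_piMr.
Qed.

Lemma opnormD (f g : blin) : opnorm (f + g) <= opnorm f + opnorm g.
Proof.
apply: opnorm_le => [|x]; first by rewrite addr_ge0 ?opnorm_ge0.
rewrite -[blin_fun (f + g) x]/(f x + g x) mulrDl.
by rewrite (le_trans (ler_normD _ _))// lerD ?opnormP.
Qed.

Lemma opnormZ (a : R) (f : blin) : opnorm (a *: f) = `|a| * opnorm f.
Proof.
have le_ b h : opnorm (b *: h) <= `|b| * opnorm h.
  apply: opnorm_le => [|x]; first by rewrite mulr_ge0 ?opnorm_ge0.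
  by rewrite -[blin_fun (b *: h) x]/(b *: h x) normrZ -mulrA ler_wpM2l ?opnormP.
apply/eqP; rewrite eq_le le_ /=.
have [->|a0] := eqVneq a 0; first by rewrite normr0 mul0r opnorm_ge0.
rewrite -ler_pdivlMl ?normr_gt0// -normfV.
by have := le_ a^-1 (a *: f); rewrite scalerA mulVf// scale1r.
Qed.

Lemma opnorm0_eq0 (f : blin) : opnorm f = 0 -> f = 0.
Proof.
move=> f0; apply/val_inj/funext => x /=.
by apply/eqP; rewrite -normr_le0 (le_trans (opnormP f x))// f0 mul0r.
Qed.

HB.instance Definition _ :=
  Lmodule_isNormed.Build R blin opnormD opnormZ opnorm0_eq0.

End BoundedLinear.

(** The library norms [U * V] by the maximum of the two norms; [sumprod U V] is
    the same vector space normed by [`|x.1| + `|x.2|]. *)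
Definition sumprod {R : realType} (U V : normedModType R) : Type := (U * V)%type.

Section SumProd.
Context {R : realType} (U V : normedModType R).

HB.instance Definition _ := GRing.Lmodule.copy (sumprod U V) (U * V)%type.

Definition sumnorm (x : sumprod U V) : R := `|x.1| + `|x.2|.

Lemma sumnormD x y : sumnorm (x + y) <= sumnorm x + sumnorm y.
Proof. by rewrite /sumnorm addrACA lerD ?ler_normD. Qed.

Lemma sumnormZ (a : R) x : sumnorm (a *: x) = `|a| * sumnorm x.
Proof. by rewrite /sumnorm !normrZ mulrDr. Qed.

Lemma sumnorm0_eq0 x : sumnorm x = 0 -> x = 0.
Proof.
move=> /eqP; rewrite paddr_eq0// !normr_eq0 => /andP[/eqP x1 /eqP x2].
by case: x x1 x2 => /= ? ? -> ->.
Qed.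

HB.instance Definition _ :=
  Lmodule_isNormed.Build R (sumprod U V) sumnormD sumnormZ sumnorm0_eq0.

End SumProd.

Section FrechetDerivatives.
Context {R : realType} {U F : normedModType R}.

(** [L(U, L(U, ... L(U, F)))], isometric to the bounded [k]-linear maps. *)
Fixpoint klin (U F : normedModType R) (k : nat) : normedModType R :=
  if k is k'.+1 then blin U (klin U F k') else F.

(** The default [0] is taken only where ['d f x] is not continuous, so never at
    a point of differentiability. *)
Definition fderiv {G : normedModType R} (f : U -> G) (x : U) : blin U G :=
  insubd (0 : blin U G) ('d f x : U -> G).

Lemma fderivE {G : normedModType R} (f : U -> G) (x : U) :
  differentiable f x -> fderiv f x = 'd f x :> (U -> G).
Proof.
move=> df; rewrite [LHS]insubdK//; apply/blin_predP; split.
  by move=> a u v; rewrite linearP.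
exact: diff_continuous.
Qed.

Fixpoint iter_fderiv (f : U -> F) (k : nat) : U -> klin U F k :=
  match k return U -> klin U F k with
  | 0 => f
  | k'.+1 => fderiv (iter_fderiv f k')
  end.

Definition cont_fdiff (n : nat) (f : U -> F) : Prop :=
  (forall k x, (k < n)%N -> differentiable (iter_fderiv f k) x) /\
  continuous (iter_fderiv f n).

End FrechetDerivatives.

Section NonlinearRoughPaths.
Context {R : realType} {V : normedModType R}.
Variables (T alpha : R).

Implicit Types (s t u : R) (Y : R -> V) (W : R -> V -> V).

(** Maps defined on the time interval [0, T] are represented by maps on [R] whose
    values outside it are never used. *)
Definition holder_norm2 (gamma : R) (Q : R -> R -> V) : \bar R :=
  ereal_sup [set z | exists s t, [/\ s \in `[0, T], t \in `[0, T], s != t &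
    z = (`|Q s t| / `|t - s| `^ gamma)%:E]].

Definition holder2 (gamma : R) (Q : R -> R -> V) : Prop :=
  (holder_norm2 gamma Q < +oo)%E.

Definition holder (gamma : R) Y : Prop :=
  holder2 gamma (fun s t => Y t - Y s).

Definition field_norm (n : nat) (beta : 'I_n.+1 -> R) W : \bar R :=
  (\sum_(k < n.+1) ereal_sup [set z | exists s t x,
     [/\ s \in `[0%R, T], t \in `[0%R, T], s != t &
      z = (`|iter_fderiv (fun y => W t y - W s y) k x| /
           (`|t - s| `^ alpha * (1 + `|x|) `^ beta k))%:E]])%E.

Definition field_space (n : nat) (beta : 'I_n.+1 -> R) W : Prop :=
  (forall t, t \in `[0, T] -> cont_fdiff n (W t)) /\
  (field_norm beta W < +oo)%E.

Definition on_pairs (Psi : V -> V -> V) : sumprod V V -> V :=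
  fun x => Psi x.1 x.2.

Definition field2_norm (gamma : R) (m : nat) (beta1 beta2 : 'I_m.+1 -> R)
    (Psi : R -> R -> V -> V -> V) : \bar R :=
  (\sum_(k < m.+1) ereal_sup [set z | exists s t (x : sumprod V V),
     [/\ s \in `[0%R, T], t \in `[0%R, T], s != t &
      z = (`|iter_fderiv (on_pairs (Psi s t)) k x| /
           (`|t - s| `^ gamma * (1 + `|x.1|) `^ beta1 k
                              * (1 + `|x.2|) `^ beta2 k))%:E]])%E.

Definition field2_space (gamma : R) (m : nat) (beta1 beta2 : 'I_m.+1 -> R)
    (Psi : R -> R -> V -> V -> V) : Prop :=
  (forall s t, s \in `[0, T] -> t \in `[0, T] ->
     cont_fdiff m (on_pairs (Psi s t))) /\
  (field2_norm gamma beta1 beta2 Psi < +oo)%E.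

Definition beta_star (m : nat) (beta : 'I_m.+2 -> R) (k : 'I_m.+1) : R :=
  \big[Num.max/beta ord0]_(j < m.+2 | (j <= k)%N) beta j.

Definition beta_star2 (m : nat) (beta : 'I_m.+2 -> R) (k : 'I_m.+1) : R :=
  \big[Num.max/beta (lift ord0 ord0)]_(j < m.+2 | (1 <= j <= k.+1)%N) beta j.

Definition chen W (WW : R -> R -> V -> V -> V) : Prop :=
  forall s u t x y, s \in `[0, T] -> u \in `[0, T] -> t \in `[0, T] ->
    WW s t x y - WW s u x y - WW u t x y =
    fderiv (fun z => W t z - W u z) y (W u x - W s x).

(** The order is [n = m.+1], so that [n >= 1] and [n - 1 = m]. *)
Definition nonlinear_rough_path (m : nat) (beta : 'I_m.+2 -> R) W
    (WW : R -> R -> V -> V -> V) : Prop :=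
  [/\ field_space beta W,
      field2_space (2 * alpha) (beta_star beta) (beta_star2 beta) WW &
      chen W WW].

(** [Yd] is the Gubinelli derivative. *)
Definition controlled W Y Yd : Prop :=
  [/\ holder alpha Y, holder alpha Yd &
      holder2 (2 * alpha) (fun s t => (Y t - Y s) - (W t (Yd s) - W s (Yd s)))].

End NonlinearRoughPaths.

Section RoughIntegral.
Context {R : realType} {V : normedModType R}.

(** A partition [a = t_0 < ... < t_n = b] is represented, as in
    [itv_partition], by [a] and the sequence [pi] of [t_1, ..., t_n]. *)
Definition partition_pt (a : R) (pi : seq R) (k : nat) : R := nth a (a :: pi) k.

Definition mesh (a : R) (pi : seq R) : R :=
  \big[Num.max/0]_(k < size pi)
     (partition_pt a pi k.+1 - partition_pt a pi k).

Definition mesh_to_0 (a b : R) : set_system (seq R) :=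
  filter_from [set d : R | 0 < d]
    (fun d => [set pi | itv_partition a b pi /\ mesh a pi < d]).

Definition rough_sum (W : R -> V -> V) (WW : R -> R -> V -> V -> V)
    (Y Yd : R -> V) (a : R) (pi : seq R) : V :=
  \sum_(k < size pi)
    let p := partition_pt a pi k in
    let q := partition_pt a pi k.+1 in
    ((W q (Y p) - W p (Y p)) + WW p q (Yd p) (Y p)).

Definition rough_integral (W : R -> V -> V) (WW : R -> R -> V -> V -> V)
    (Y Yd : R -> V) (a b : R) : V :=
  lim (rough_sum W WW Y Yd a @ mesh_to_0 a b).

End RoughIntegral.

(* Main.v *)
Require Import Defs.
From mathcomp Require Import all_boot all_order all_algebra.
From mathcomp Require Import all_classical all_reals all_analysis.
From mathcomp Require Import lra ring.
Set Implicit Arguments.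
Unset Strict Implicit.
Import Order.TTheory GRing.Theory Num.Theory.
Import numFieldNormedType.Exports.
Local Open Scope classical_set_scope.
Local Open Scope ring_scope.

(** The integral is approximated on a short interval by its germ
    [Xi_{s,t} = W_{s,t}(Y_s) + WW_{s,t}(Yd_s, Y_s)], and the claim follows from
    the sewing estimate [|Z_{s,t} - Xi_{s,t}| <= K |t - s|^(3 alpha)]: the second
    term of the germ is [O(|t - s|^(2 alpha))], hence so is
    [Z_{s,t} - W_{s,t}(Y_s)], which says that [Y] is the Gubinelli derivative.

    The sewing estimate needs the germ to be additive up to
    [O(|t - s|^(3 alpha))], with [3 alpha > 1] ([germ_defect]).  By Chen's
    relation, and writing [w = W_{u,t}], the defect
    [Xi_{s,t} - Xi_{s,u} - Xi_{u,t}] is, up to sign, the sum of the first-order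
    Taylor remainder of [w] between [Y_s] and [Y_u], of the derivative
    [Dw(Y_s)] applied to the remainder [R^Y_{s,u}], and of the increment of
    [WW_{u,t}] between [(Yd_s, Y_s)] and [(Yd_u, Y_u)].  Since [Y] and [Yd] are
    bounded, everything happens in a ball, where the weights
    [(1 + |x|)^beta_k] are bounded ([rough_path_local_bounds]); the Taylor
    remainder is controlled by the mean value inequality applied twice
    ([taylor2_bound]).

    For the sewing estimate, a Riemann sum over any partition of [[s, t]] is
    within [K (t - s)^theta] of [Xi_{s,t}] ([riemann_sum_bound]): cut the
    partition at the interval that crosses the midpoint of [[s, t]], treat the
    two sides, of length at most [(t - s) / 2], by induction, and pay twice the
    defect; as [theta > 1] the constant closes up.  Summed over the intervals of
    a partition of mesh [d], this bounds the effect of a refinement by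
    [K d^(theta - 1) (t - s)] ([riemann_sum_refine]), so that Riemann sums are
    Cauchy as the mesh tends to 0.  Finally, gluing a fine partition of [[0, s]]
    and one of [[s, t]] gives a fine partition of [[0, t]], which turns the bound
    on sums over [[s, t]] into the bound on [Z_t - Z_s] ([sewing]). *)

(** Decides identities of abelian groups between signed sums of atoms: with
    everything on one side and fully right-nested, the head of the sum is moved
    to the right until it meets its opposite. *)
Ltac zmod :=
  apply/eqP; rewrite -subr_eq0; apply/eqP;
  rewrite !(opprD, opprK) -!addrA ?(addr0, add0r, oppr0);
  repeat (match goal with
  | |- (- ?x) + _ = 0 => zmod_neg x
  | |- ?x + _ = 0 => zmod_pos x
  end; rewrite ?(addr0, add0r)); try reflexivity
with zmod_pos x := first
  [ rewrite (addNKr x) | rewrite (addrN x)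
  | match goal with |- context [x + (?y + ?z)] =>
      rewrite (addrCA x y z); zmod_pos x end ]
with zmod_neg x := first
  [ rewrite (addKr x) | rewrite (addNr x)
  | match goal with |- context [(- x) + (?y + ?z)] =>
      rewrite (addrCA (- x) y z); zmod_neg x end ].

(** * Mean value inequality for Frechet derivatives *)

Section Calculus.
Context {R : realType}.

(** Vector-valued functions have no mean value theorem; instead, the set of
    the [t] where the bound [|phi t - phi 0| <= L t] holds contains 0, contains
    its supremum, and cannot have a supremum below 1, since at each point the
    local bound extends it in both directions. *)
Lemma locally_lipschitz_segment (F : normedModType R) (phi : R -> F) (L : R) :
  (forall c, 0 <= c <= 1 -> exists2 d, 0 < d & forall t, 0 <= t <= 1 ->
     `|t - c| < d -> `|phi t - phi c| <= L * `|t - c|) ->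
  `|phi 1 - phi 0| <= L.
Proof.
move=> locL.
pose A := [set t : R | 0 <= t <= 1 /\ `|phi t - phi 0| <= L * t].
have A0 : A 0 by split; rewrite ?lexx ?ler01// subrr normr0 mulr0.
have ubA : ubound A 1 by move=> t [/andP[]].
have supA : has_sup A by split; [exists 0 | exists 1].
have c01 : 0 <= sup A <= 1.
  by apply/andP; split; [apply: ub_le_sup => //; exists 1 | apply: ge_sup => //; exists 0].
have [d d0 locc] := locL _ c01.
have Ac : A (sup A).
  split=> //; have [t At dt] := sup_adherent d0 supA.
  have tc : t <= sup A by apply: ub_le_sup => //; exists 1.
  have [t01 tL] := At.
  have := locc t t01; rewrite distrC ger0_norm ?subr_ge0// => /(_ _).
  rewrite ltrBlDr -ltrBlDl => /(_ dt) ct.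
  rewrite (le_trans (ler_distD (phi t) _ _))// distrC.
  by rewrite (le_trans (lerD ct tL))// -mulrDr subrK.
have [c1|c1] := eqVneq (sup A) 1.
  by case: Ac => _; rewrite c1 mulr1.
have {c1} c1 : sup A < 1 by rewrite lt_neqAle c1/=; case/andP: c01.
pose h := Num.min (1 - sup A) (d / 2).
have h0 : 0 < h by rewrite lt_min subr_gt0 c1 divr_gt0.
have h1 : sup A + h <= 1 by rewrite -lerBrDl ge_min lexx.
have hd : h < d by rewrite (@le_lt_trans _ _ (d / 2)) ?ge_min ?lexx ?orbT//; lra.
have ch01 : 0 <= sup A + h <= 1 by case/andP: c01 => c0 _; rewrite addr_ge0// ltW.
suff : sup A + h <= sup A by rewrite gerDl leNgt h0.
apply: ub_le_sup; first by exists 1.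
split=> //; have [_ cL] := Ac.
have := locc _ ch01; rewrite addrAC subrr add0r gtr0_norm// => /(_ hd) ch.
by rewrite (le_trans (ler_distD (phi (sup A)) _ _))// mulrDr addrC lerD.
Qed.

Lemma fderiv_approx (U F : normedModType R) (f : U -> F) (x : U) (e : R) :
  0 < e -> differentiable f x -> exists2 d, 0 < d &
    forall h, `|h| < d -> `|f (x + h) - f x - fderiv f x h| <= e * `|h|.
Proof.
move=> e0 df.
have /eqaddoP /(_ e e0) := diff_locally df.
move=> /nbhs_ballP[d /= d0 fd]; exists d => // h hd.
have /fd /= : ball 0 d h by rewrite -ball_normE/= sub0r normrN.
rewrite -[(_ - _) h]/(f (h + x) - (f x + 'd f x h)).
by rewrite -(fderivE df) [h + x]addrC opprD addrA.
Qed.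

Lemma ball_segment (U : normedModType R) (M c : R) (x y : U) :
  `|x| <= M -> `|y| <= M -> 0 <= c <= 1 -> `|x + c *: (y - x)| <= M.
Proof.
move=> xM yM /andP[c0 c1].
have -> : x + c *: (y - x) = (1 - c) *: x + c *: y.
  by rewrite scalerBr scalerBl scale1r; zmod.
rewrite (le_trans (ler_normD _ _))// !normrZ !ger0_norm ?subr_ge0//.
have -> : M = (1 - c) * M + c * M by ring.
by rewrite lerD ?ler_wpM2l// subr_ge0.
Qed.

(** With [A = 0] this is the mean value inequality; [A = fderiv f x] gives the
    Taylor remainder.  The derivative only yields the local Lipschitz constant
    [K + e'] along the segment, whence the passage to the limit in [e]. *)
Lemma fderiv_mean_value (U F : normedModType R) (f : U -> F) (A : blin U F)
    (K : R) (x y : U) :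
  (forall c, 0 <= c <= 1 -> let z := x + c *: (y - x) in
     differentiable f z /\ `|fderiv f z - A| <= K) ->
  `|f y - f x - A (y - x)| <= K * `|y - x|.
Proof.
move=> dfK; apply/ler_addgt0Pr => e e0.
pose e' := e / (1 + `|y - x|).
have n0 : 0 < 1 + `|y - x| by rewrite ltr_pwDl.
have e'0 : 0 < e' by rewrite divr_gt0.
pose phi c := f (x + c *: (y - x)) - A (c *: (y - x)).
have -> : f y - f x - A (y - x) = phi 1 - phi 0.
  by rewrite /phi !scale1r scale0r addr0 linear0 subrKC; zmod.
apply: (@le_trans _ _ ((K + e') * `|y - x|)); last first.
  rewrite mulrDl lerD2l /e' mulrAC ler_pdivrMr// ler_pM2l//.
  by rewrite lerDr.
apply: locally_lipschitz_segment => c c01.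
have [df dK] := dfK c c01.
have [d d0 fd] := fderiv_approx e'0 df.
exists (d / (1 + `|y - x|)); first by rewrite divr_gt0.
move=> t _ td; pose h := (t - c) *: (y - x).
have hd : `|h| < d.
  rewrite normrZ; move: td; rewrite ltr_pdivlMr//; apply: le_lt_trans.
  by rewrite ler_wpM2l// lerDr.
have xt : x + t *: (y - x) = x + c *: (y - x) + h.
  by rewrite -addrA -scalerDl subrKC.
rewrite /phi xt; set z := x + c *: (y - x) in df dK fd xt *.
have -> : f (z + h) - A (t *: (y - x)) - (f z - A (c *: (y - x))) =
    (f (z + h) - f z - fderiv f z h) + (fderiv f z - A) h.
  rewrite -[blin_fun (fderiv f z - A) h]/(fderiv f z h - A h).
  have -> : t *: (y - x) = c *: (y - x) + h by rewrite -scalerDl subrKC.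
  by rewrite linearD/=; zmod.
rewrite (le_trans (ler_normD _ _))//.
rewrite -mulrA [X in _ <= _ * X]mulrC -normrZ mulrDl addrC lerD// ?fd//.
by rewrite (le_trans (opnormP _ _))// ler_wpM2r.
Qed.

Lemma fderiv_lipschitz (U F : normedModType R) (f : U -> F) (K M : R) (x y : U) :
  (forall z, `|z| <= M -> differentiable f z /\ `|fderiv f z| <= K) ->
  `|x| <= M -> `|y| <= M -> `|f y - f x| <= K * `|y - x|.
Proof.
move=> dfK xM yM; rewrite -[X in `|X|]subr0.
apply: (@fderiv_mean_value _ _ f 0) => c c01 z; rewrite subr0.
exact/dfK/ball_segment.
Qed.

(** On the segment from [x] to [y], [fderiv f] stays within [K |y - x|] of
    [fderiv f x]. *)
Lemma taylor2_bound (U F : normedModType R) (f : U -> F) (K M : R) (x y : U) :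
  (forall z, `|z| <= M -> [/\ differentiable f z,
     differentiable (fderiv f) z & `|fderiv (fderiv f) z| <= K]) ->
  `|x| <= M -> `|y| <= M ->
  `|f y - f x - fderiv f x (y - x)| <= K * `|y - x| ^+ 2.
Proof.
move=> dfK xM yM; rewrite expr2 mulrA; apply: fderiv_mean_value => c c01 z.
have zM : `|z| <= M by exact: ball_segment.
have [df _ _] := dfK z zM; split=> //.
have K0 : 0 <= K by have [_ _] := dfK z zM; apply: le_trans.
rewrite (le_trans (fderiv_lipschitz (K := K) (M := M) _ xM zM))//.
  by move=> w /dfK[].
have [c0 c1] := andP c01.
by rewrite addrC addKr normrZ ger0_norm// ler_wpM2l// ler_piMl.
Qed.

End Calculus.

(** * From norms to pointwise bounds on balls *)

Section Bounds.
Context {R : realType}.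

Lemma differentiable_iter_fderivB (U F : normedModType R) (n : nat) (f g : U -> F) :
  cont_fdiff n f -> cont_fdiff n g -> forall k x, (k < n)%N ->
  differentiable (iter_fderiv (fun y => f y - g y) k) x.
Proof.
move=> [df _] [dg _].
suff H k : (k < n)%N -> iter_fderiv (fun y => f y - g y) k =
    (fun y => iter_fderiv f k y - iter_fderiv g k y).
  by move=> k x kn; rewrite H//; apply: differentiableB; [exact: df|exact: dg].
elim: k => //= k IH kn; rewrite IH ?(ltn_trans _ kn)//.
have {}df x := df k x (ltnW kn); have {}dg x := dg k x (ltnW kn).
apply/funext => x; apply/val_inj => /=.
rewrite -[RHS]/(fderiv (iter_fderiv f k) x \- fderiv (iter_fderiv g k) x).
rewrite fderivE; last exact: differentiableB.
rewrite (fderivE (df x)) (fderivE (dg x)).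
exact: (diffB (df x) (dg x)).
Qed.

(** In a sum of extended reals a term [-oo] absorbs a term [+oo]; an element
    [>= 0] in each set excludes this, so that every supremum is finite. *)
Lemma sum_sup_bound (n : nat) (S : 'I_n -> set (\bar R)) :
  (forall k, exists2 z, S k z & (0 <= z)%E) ->
  (\sum_(k < n) ereal_sup (S k) < +oo)%E ->
  exists2 C : R, 0 <= C & forall k z, S k z -> (z <= C%:E)%E.
Proof.
move=> S0 Soo.
have sup0 k : (0 <= ereal_sup (S k))%E.
  by have [z Sz z0] := S0 k; rewrite (le_trans z0)// ereal_sup_ubound.
have sum0 : (0 <= \sum_(k < n) ereal_sup (S k))%E by exact: sume_ge0.
exists (fine (\sum_(k < n) ereal_sup (S k))); first exact: fine_ge0.
move=> k z Sz; rewrite fineK ?ge0_fin_numE//.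
rewrite (le_trans (ereal_sup_ubound Sz))// (bigD1 k)//= leeDl// sume_ge0//.
Qed.

(** The absolute value makes the bound valid whatever the sign of the exponent. *)
Lemma powR_1D_le (b M r : R) : 0 <= r <= M -> (1 + r) `^ b <= (1 + M) `^ `|b|.
Proof.
move=> /andP[r0 rM]; have M0 := le_trans r0 rM.
apply: (@le_trans _ _ ((1 + r) `^ `|b|)).
  by rewrite ler_powR ?lerDl// ler_norm.
by rewrite ge0_ler_powR ?nnegrE ?addr_ge0// lerD2l.
Qed.

End Bounds.

Section NormBounds.
Context {R : realType} {V : normedModType R} (T alpha : R) (T0 : 0 < T).

Let in0 : 0 \in `[0, T]. Proof. by rewrite in_itv/= lexx ltW. Qed.
Let inT : T \in `[0, T]. Proof. by rewrite in_itv/= lexx andbT ltW. Qed.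

Lemma holder2P (gamma : R) (Q : R -> R -> V) :
  holder2 T gamma Q <-> exists2 C : R, 0 <= C & forall s t,
    s \in `[0, T] -> t \in `[0, T] -> s != t ->
    `|Q s t| <= C * `|t - s| `^ gamma.
Proof.
rewrite /holder2 /holder_norm2; set S := [set z | _]; split; last first.
  move=> [C C0 QC]; apply: (@le_lt_trans _ _ C%:E); last exact: ltry.
  apply: ub_ereal_sup => _ [s [t [sT tT st ->]]].
  rewrite lee_fin ler_pdivrMr ?QC//.
  by rewrite powR_gt0// normr_gt0 subr_eq0 eq_sym.
move=> Soo; pose S1 (k : 'I_1) := S.
have [||C C0 SC] := @sum_sup_bound _ _ S1.
- move=> k; exists (`|Q 0 T| / `|T - 0| `^ gamma)%:E.
    by exists 0, T; rewrite in0 inT lt_eqF.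
  by rewrite lee_fin divr_ge0// powR_ge0.
- by rewrite big_ord1.
exists C => // s t sT tT st.
rewrite -ler_pdivrMr ?powR_gt0 ?normr_gt0 ?subr_eq0 1?eq_sym// -lee_fin.
by apply: (SC ord0); exists s, t.
Qed.

Lemma field_norm_bound (n : nat) (beta : 'I_n.+1 -> R) (W : R -> V -> V) (M : R)
    (k : 'I_n.+1) : 0 <= M -> (field_norm T alpha beta W < +oo)%E ->
  exists2 C : R, 0 <= C & forall s t x,
    s \in `[0, T] -> t \in `[0, T] -> s != t -> `|x| <= M ->
    `|iter_fderiv (fun y => W t y - W s y) k x| <= C * `|t - s| `^ alpha.
Proof.
move=> M0; rewrite /field_norm => /sum_sup_bound[|C C0 WC].
  move=> j.
  exists (`|iter_fderiv (fun y => W T y - W 0 y) j 0| /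
           (`|T - 0| `^ alpha * (1 + `|0 : V|) `^ beta j))%:E.
    by exists 0, T, 0; rewrite in0 inT lt_eqF.
  by rewrite lee_fin divr_ge0// mulr_ge0// powR_ge0.
exists (C * (1 + M) `^ `|beta k|); first by rewrite mulr_ge0// powR_ge0.
move=> s t x sT tT st xM.
have {}WC : `|iter_fderiv (fun y => W t y - W s y) k x| /
           (`|t - s| `^ alpha * (1 + `|x|) `^ beta k) <= C.
  by rewrite -lee_fin; apply: (WC k); exists s, t, x.
have ts0 : 0 < `|t - s| by rewrite normr_gt0 subr_eq0 eq_sym.
move: WC; rewrite ler_pdivrMr ?mulr_gt0 ?powR_gt0 ?ltr_pwDl// => /le_trans; apply.
rewrite -[leRHS]mulrA ler_wpM2l// mulrC ler_wpM2r ?powR_ge0//.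
by rewrite powR_1D_le// normr_ge0.
Qed.

(** The norm of [sumprod V V] dominates both components, so that a ball of it is
    controlled by both weights. *)
Lemma field2_norm_bound (gamma : R) (m : nat) (beta1 beta2 : 'I_m.+1 -> R)
    (Psi : R -> R -> V -> V -> V) (M : R) (k : 'I_m.+1) : 0 <= M ->
  (field2_norm T gamma beta1 beta2 Psi < +oo)%E ->
  exists2 C : R, 0 <= C & forall s t x,
    s \in `[0, T] -> t \in `[0, T] -> s != t -> `|x| <= M ->
    `|iter_fderiv (on_pairs (Psi s t)) k x| <= C * `|t - s| `^ gamma.
Proof.
move=> M0; rewrite /field2_norm => /sum_sup_bound[|C C0 PC].
  move=> j.
  exists (`|iter_fderiv (on_pairs (Psi 0 T)) j 0| /
           (`|T - 0| `^ gamma * (1 + `|(0 : sumprod V V).1|) `^ beta1 j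
                              * (1 + `|(0 : sumprod V V).2|) `^ beta2 j))%:E.
    by exists 0, T, 0; rewrite in0 inT lt_eqF.
  by rewrite lee_fin divr_ge0// !mulr_ge0// powR_ge0.
exists (C * ((1 + M) `^ `|beta1 k| * (1 + M) `^ `|beta2 k|)).
  by rewrite !mulr_ge0// powR_ge0.
move=> s t x sT tT st xM.
have {}PC : `|iter_fderiv (on_pairs (Psi s t)) k x| /
           (`|t - s| `^ gamma * (1 + `|x.1|) `^ beta1 k
                              * (1 + `|x.2|) `^ beta2 k) <= C.
  by rewrite -lee_fin; apply: (PC k); exists s, t, x.
have ts0 : 0 < `|t - s| by rewrite normr_gt0 subr_eq0 eq_sym.
move: PC; rewrite ler_pdivrMr ?mulr_gt0 ?powR_gt0 ?ltr_pwDl// => /le_trans; apply.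
rewrite -[leRHS]mulrA ler_wpM2l// -mulrA mulrC ler_wpM2r ?powR_ge0//.
have xN : `|x| = `|x.1| + `|x.2| by [].
by rewrite ler_pM ?powR_ge0// powR_1D_le// normr_ge0 (le_trans _ xM)// xN ?lerDl ?lerDr.
Qed.

End NormBounds.

(** * The germ of the rough integral and its additivity defect *)

Section Germ.
Context {R : realType} {V : normedModType R} (T alpha : R).

Lemma powR_natl_mul (x a : R) (n : nat) : x `^ (n%:R * a) = (x `^ a) ^+ n.
Proof. by rewrite mulrC powRrM powR_mulrn// powR_ge0. Qed.

Lemma holder_bounded (Y : R -> V) : 0 < T -> 0 <= alpha -> holder T alpha Y ->
  exists2 M, 0 <= M & forall t, t \in `[0, T] -> `|Y t| <= M.
Proof.
move=> T0 a0 /(holder2P T0)[C C0 YC].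
exists (`|Y 0| + C * T `^ alpha); first by rewrite addr_ge0// mulr_ge0// powR_ge0.
move=> t tT; have [->|t0] := eqVneq t 0; first by rewrite lerDl mulr_ge0// powR_ge0.
have /andP[t0' tT'] : 0 <= t <= T by move: tT; rewrite in_itv.
rewrite -[Y t](subrKC (Y 0)) (le_trans (ler_normD _ _))// lerD2l.
rewrite (le_trans (YC 0 t _ tT _))//; first by rewrite in_itv/= lexx ltW.
  by rewrite eq_sym.
by rewrite ler_wpM2l// ge0_ler_powR ?nnegrE// ?(ltW T0)// subr0 ger0_norm.
Qed.

Variables (beta : 'I_3 -> R) (W : R -> V -> V) (WW : R -> R -> V -> V -> V).
Hypotheses (T0 : 0 < T) (rough_W : nonlinear_rough_path T alpha beta W WW).

(** Everything that the estimates use from the rough path: on a ball the weights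
    are constants, and a single [C] serves all the derivatives.  The bound on the
    increments of [WW] is the mean value inequality on pairs, which is why the
    derivatives are bounded on a ball of radius [M + M] of [sumprod V V]. *)
Lemma rough_path_local_bounds (M : R) : 0 <= M ->
  exists2 C : R, 0 <= C & forall s t, s \in `[0, T] -> t \in `[0, T] -> s != t ->
    let w := fun z => W t z - W s z in
    (forall x, `|x| <= M -> `|w x| <= C * `|t - s| `^ alpha /\
       forall v, `|fderiv w x v| <= C * `|t - s| `^ alpha * `|v|) /\
    (forall x y, `|x| <= M -> `|y| <= M ->
      [/\ `|w y - w x| <= C * `|t - s| `^ alpha * `|y - x|,
          `|w y - w x - fderiv w x (y - x)| <=
             C * `|t - s| `^ alpha * `|y - x| ^+ 2 &
          `|WW s t x y| <= C * `|t - s| `^ (2 * alpha)]) /\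
    (forall x y x' y', `|x| <= M -> `|y| <= M -> `|x'| <= M -> `|y'| <= M ->
      `|WW s t x' y' - WW s t x y| <=
         C * `|t - s| `^ (2 * alpha) * (`|x' - x| + `|y' - y|)).
Proof.
move=> M0; have [[dW nW] [dWW nWW] _] := rough_W.
have MM : 0 <= M + M by rewrite addr_ge0.
have [C0 C00 WC0] := field_norm_bound T0 ord0 M0 nW.
have [C1 C10 WC1] := field_norm_bound T0 (lift ord0 ord0) M0 nW.
have [C2 C20 WC2] := field_norm_bound T0 ord_max M0 nW.
have [B0 B00 WB0] := field2_norm_bound T0 ord0 MM nWW.
have [B1 B10 WB1] := field2_norm_bound T0 ord_max MM nWW.
exists (C0 + C1 + C2 + B0 + B1); first by rewrite !addr_ge0.
move=> s t sT tT st w.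
have dw k x := differentiable_iter_fderivB (dW t tT) (dW s sT) (k := k) x.
have le_C c (p : R) : c <= C0 + C1 + C2 + B0 + B1 -> 0 <= p ->
  c * p <= (C0 + C1 + C2 + B0 + B1) * p by move=> ? ?; rewrite ler_wpM2r.
have p0 := powR_ge0 `|t - s|.
split; [|split].
- move=> x xM; split.
    by rewrite (le_trans (WC0 s t x sT tT st xM))// le_C//; lra.
  move=> v; rewrite (le_trans (opnormP _ _))// ler_wpM2r//.
  by rewrite (le_trans (WC1 s t x sT tT st xM))// le_C//; lra.
- move=> x y xM yM; split.
  + rewrite (@le_trans _ _ (C1 * `|t - s| `^ alpha * `|y - x|))//; last first.
      by rewrite ler_wpM2r// le_C//; lra.
    apply: fderiv_lipschitz xM yM => z zM; split; first exact: (dw 0%N).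
    exact: (WC1 s t z sT tT st zM).
  + rewrite (@le_trans _ _ (C2 * `|t - s| `^ alpha * `|y - x| ^+ 2))//; last first.
      by rewrite ler_wpM2r ?exprn_ge0// le_C//; lra.
    apply: taylor2_bound xM yM => z zM; split; [exact: (dw 0%N)|exact: (dw 1%N)|].
    exact: (WC2 s t z sT tT st zM).
  + have xyM : `|(x, y) : sumprod V V| <= M + M by exact: lerD.
    by rewrite (le_trans (WB0 s t _ sT tT st xyM))// le_C//; lra.
- move=> x y x' y' xM yM xM' yM'.
  rewrite (@le_trans _ _ (B1 * `|t - s| `^ (2 * alpha) * (`|x' - x| + `|y' - y|)))//; last first.
    by rewrite ler_wpM2r ?addr_ge0// le_C//; lra.
  have H := @fderiv_lipschitz _ _ _ (on_pairs (WW s t)) (B1 * `|t - s| `^ (2 * alpha))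
    (M + M) ((x, y) : sumprod V V) ((x', y') : sumprod V V).
  apply: H; [|exact: lerD|exact: lerD].
  move=> z zM; split; first exact: ((dWW s t sT tT).1 0%N).
  exact: (WB1 s t z sT tT st zM).
Qed.

Definition germ (Y Yd : R -> V) (s t : R) : V :=
  (W t (Y s) - W s (Y s)) + WW s t (Yd s) (Y s).

Variables (Y Yd : R -> V).
Hypotheses (alpha0 : 0 < alpha) (controlled_Y : controlled T alpha W Y Yd).

(** Chen's relation at [s = u = t] forces [WW s s = 0]. *)
Lemma germ_diag (s : R) : s \in `[0, T] -> germ Y Yd s s = 0.
Proof.
move=> sT; have [_ _ /(_ s s s (Yd s) (Y s) sT sT sT)] := rough_W.
rewrite /germ !subrr linear0 sub0r add0r => /eqP.
by rewrite oppr_eq0 => /eqP.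
Qed.

(** Each of the three terms of the defect is a product of Hoelder factors of
    total exponent [3 alpha]. *)
Lemma germ_defect : exists2 C, 0 <= C & forall s u t,
  0 <= s -> s <= u -> u <= t -> t <= T ->
  `|germ Y Yd s t - germ Y Yd s u - germ Y Yd u t| <= C * (t - s) `^ (3 * alpha).
Proof.
have [hY hYd hR] := controlled_Y.
have [M1 M10 YM1] := holder_bounded T0 (ltW alpha0) hY.
have [M2 M20 YM2] := holder_bounded T0 (ltW alpha0) hYd.
have M0 : 0 <= M1 + M2 by exact: addr_ge0.
have [C C0 WC] := rough_path_local_bounds M0.
move: hY hYd hR => /(holder2P T0)[C1 C10 YC] /(holder2P T0)[C2 C20 YdC].
move=> /(holder2P T0)[C3 C30 RC].
exists (C * (C1 ^+ 2 + C3 + (C2 + C1))).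
  by rewrite mulr_ge0// !addr_ge0// exprn_ge0.
move=> s u t s0 su ut tT.
have sI : s \in `[0, T] by rewrite in_itv/= s0 (le_trans su)// (le_trans ut).
have uI : u \in `[0, T] by rewrite in_itv/= (le_trans s0 su) (le_trans ut).
have tI : t \in `[0, T] by rewrite in_itv/= tT (le_trans s0)// (le_trans su).
have [us|us] := eqVneq s u.
  rewrite us germ_diag// subr0 subrr normr0.
  by rewrite !mulr_ge0 ?powR_ge0// !addr_ge0// exprn_ge0.
have [tu|tu] := eqVneq u t.
  rewrite tu germ_diag// subr0 subrr normr0.
  by rewrite !mulr_ge0 ?powR_ge0// !addr_ge0// exprn_ge0.
have YM r : r \in `[0, T] -> `|Y r| <= M1 + M2.
  by move=> rT; rewrite (le_trans (YM1 r rT))// lerDl.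
have YdM r : r \in `[0, T] -> `|Yd r| <= M1 + M2.
  by move=> rT; rewrite (le_trans (YM2 r rT))// lerDr.
have [Ww [Wt WWl]] := WC u t uI tI tu.
have {}Ww := (Ww (Y s) (YM s sI)).2.
have {Wt} [_ Wt _] := Wt (Y s) (Y u) (YM s sI) (YM u uI).
have {}WWl := WWl (Yd s) (Y s) (Yd u) (Y u) (YdM s sI) (YM s sI) (YdM u uI) (YM u uI).
have {}YC := YC s u sI uI us; have {}YdC := YdC s u sI uI us.
have {}RC := RC s u sI uI us.
have Chen := (let: And3 _ _ c := rough_W in c) s u t (Yd s) (Y s) sI uI tI.
set w := (fun z => W t z - W u z) in Ww Wt Chen.
set rem := Y u - Y s - (W u (Yd s) - W s (Yd s)) in RC.
have -> : germ Y Yd s t - germ Y Yd s u - germ Y Yd u t =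
  - (w (Y u) - w (Y s) - fderiv w (Y s) (Y u - Y s)) - fderiv w (Y s) rem
  - (WW u t (Yd u) (Y u) - WW u t (Yd s) (Y s)).
  have -> : fderiv w (Y s) rem = fderiv w (Y s) (Y u - Y s) -
      (WW s t (Yd s) (Y s) - WW s u (Yd s) (Y s) - WW u t (Yd s) (Y s)).
    by rewrite Chen /rem linearB.
  by rewrite /germ /w; zmod.
have mono r r' : 0 <= r <= r' -> r `^ alpha <= r' `^ alpha.
  by move=> /andP[r0 rr']; rewrite ge0_ler_powR ?nnegrE// ?(le_trans r0 rr')// ltW.
have pu : `|u - s| `^ alpha <= (t - s) `^ alpha.
  by rewrite ger0_norm ?subr_ge0// mono// subr_ge0 su lerB.
have pt : `|t - u| `^ alpha <= (t - s) `^ alpha.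
  by rewrite ger0_norm ?subr_ge0// mono// subr_ge0 ut lerB.
have p0 := powR_ge0 `|t - u| alpha; have q0 := powR_ge0 `|u - s| alpha.
move: WWl RC; rewrite !powR_natl_mul.
move: Ww Wt YC YdC pu pt p0 q0.
set p := (t - s) `^ alpha; set p1 := `|t - u| `^ alpha; set p2 := `|u - s| `^ alpha.
move=> Ww Wt YC YdC pu pt p0 q0 WWl RC.
have P0 : 0 <= p by exact: le_trans pu.
rewrite (le_trans (ler_normB _ _))//.
have -> : C * (C1 ^+ 2 + C3 + (C2 + C1)) * p ^+ 3 =
  (C * p * (C1 * p) ^+ 2 + C * p * (C3 * p ^+ 2)) + C * p ^+ 2 * (C2 * p + C1 * p).
  by ring.
have leC (c a b : R) : 0 <= c -> a <= b -> c * a <= c * b by move=> *; rewrite ler_wpM2l.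
rewrite lerD//; last first.
  rewrite (le_trans WWl)// ler_pM ?addr_ge0 ?mulr_ge0 ?exprn_ge0//.
    by rewrite leC// lerXn2r ?nnegrE.
  by rewrite lerD// ?(le_trans YC) ?(le_trans YdC)// leC.
rewrite (le_trans (ler_normB _ _))// normrN lerD//.
  rewrite (le_trans Wt)// ler_pM ?mulr_ge0 ?exprn_ge0// ?leC//.
  by rewrite lerXn2r ?nnegrE ?mulr_ge0// (le_trans YC)// leC.
rewrite (le_trans (Ww _))// ler_pM ?mulr_ge0// ?leC//.
by rewrite (le_trans RC)// leC// lerXn2r ?nnegrE.
Qed.

End Germ.

(** * Partitions of small mesh *)

Section Partitions.
Context {R : realType}.
Implicit Types (a b d : R) (pi : seq R).

Lemma partition_pt_cons a u pi k : (k <= size pi)%N ->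
  partition_pt a (u :: pi) k.+1 = partition_pt u pi k.
Proof.
rewrite /partition_pt /=; case: k => //= k kn.
by rewrite (set_nth_default u).
Qed.

Lemma mesh_cons a u pi : mesh a (u :: pi) = Num.max (u - a) (mesh u pi).
Proof.
rewrite /mesh big_ord_recl; congr Num.max.
by apply: eq_bigr => i _; rewrite lift0 !partition_pt_cons// ltnW.
Qed.

Lemma mesh_cat_lt a pi pi' d :
  (mesh a (pi ++ pi') < d) = (mesh a pi < d) && (mesh (last a pi) pi' < d).
Proof.
elim: pi a => [|u pi IH] a; last by rewrite /= !mesh_cons !gt_max IH andbA.
rewrite /= {2}/mesh big_ord0; apply/idP/andP => [md|[]//]; split=> //.
by apply: le_lt_trans md; exact: bigmax_ge_id.
Qed.

Lemma path_lt_le_last a pi : path <%R a pi -> a <= last a pi.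
Proof.
by elim: pi a => //= u pi IH a /andP[au /IH]; apply: le_trans; apply: ltW.
Qed.

(** Steps of length [d / 2], until the right end is at most one step away. *)
Lemma fine_partition_exists a b d : a <= b -> 0 < d ->
  exists pi, itv_partition a b pi /\ mesh a pi < d.
Proof.
move=> ab d0; pose e := d / 2; have e0 : 0 < e by rewrite divr_gt0.
have ed : e < d by rewrite /e; lra.
suff H n : forall a, a <= b -> b - a <= n%:R * e ->
    exists pi, itv_partition a b pi /\ mesh a pi < d.
  have be0 : 0 <= (b - a) / e by apply: divr_ge0; rewrite ?subr_ge0// ltW.
  apply: (H (Num.bound ((b - a) / e)) a ab).
  by rewrite -ler_pdivrMr// ltW// archi_boundP.
elim: n => [|n IH] {}a {}ab abn.
  exists [::]; split; last by rewrite /mesh big_ord0.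
  by split=> //=; apply/eqP/le_anti; rewrite ab -subr_le0 -(mul0r e).
have [bae|bae] := leP (b - a) e.
  have [<-|nab] := eqVneq a b; first by exists [::]; split=> //; rewrite /mesh big_ord0.
  exists [:: b]; split; first by split=> //=; rewrite andbT lt_neqAle nab.
  by rewrite mesh_cons gt_max (le_lt_trans bae)//= /mesh big_ord0.
have [||pi [[ppi lpi] mpi]] := IH (a + e).
- by rewrite -lerBrDl ltW.
- by rewrite opprD addrA lerBlDr (le_trans abn)// mulrSr mulrDl mul1r.
exists ((a + e) :: pi); split; first by split=> //=; rewrite ltrDl e0.
by rewrite mesh_cons gt_max mpi andbT [a + e]addrC addrK.
Qed.

Lemma mesh_to_0_proper a b : a <= b -> ProperFilter (mesh_to_0 a b).
Proof.
move=> ab; apply: filter_from_proper; last by move=> d; exact: fine_partition_exists.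
apply: filter_from_filter; first by exists 1 => /=.
move=> d d' /= d0 d'0; exists (Num.min d d'); first by rewrite /= lt_min d0.
by move=> pi [ppi]; rewrite lt_min => /andP[].
Qed.

Lemma path_crossing a pi m : a <= m -> m < last a pi ->
  exists l u r, pi = l ++ u :: r /\ last a l <= m < u.
Proof.
elim: pi a => [|u pi IH] a /= am ml.
  by move: (le_lt_trans am ml); rewrite ltxx.
have [um|mu] := leP u m; last by exists [::], u, pi; rewrite /= am.
have [l [v [r [-> lv]]]] := IH u um ml.
by exists (u :: l), v, r.
Qed.

Lemma common_refinement a b pi pi' :
  itv_partition a b pi -> itv_partition a b pi' ->
  exists2 sigma, itv_partition a b sigma &
    {subset pi <= sigma} /\ {subset pi' <= sigma}.
Proof.
move=> [p l] [p' l'].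
pose sigma := sort <=%R (undup (pi ++ pi')).
have mem_sigma x : (x \in sigma) = (x \in pi) || (x \in pi').
  by rewrite mem_sort mem_undup mem_cat.
have gt_a x : x \in sigma -> a < x.
  rewrite mem_sigma => /orP[]; [move: p|move: p'].
    by move=> /(order_path_min lt_trans)/allP; apply.
  by move=> /(order_path_min lt_trans)/allP; apply.
have psigma : path <%R a sigma.
  rewrite path_sortedE; last exact: lt_trans.
  by rewrite sort_lt_sorted undup_uniq andbT; apply/allP.
have le_last q x : path <%R a q -> x \in q -> x <= last a q.
  move=> pq /splitPr xq; case: xq pq => q1 q2.
  by rewrite cat_path /= last_cat => /and3P[_ _ /path_lt_le_last].
exists sigma; last by split=> x xp; rewrite mem_sigma xp ?orbT.
split=> //; apply/eqP/le_anti.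
have b_sigma : b \in a :: sigma.
  rewrite -(eqP l) inE mem_sigma; case: (pi) => [|u q] /=; first by rewrite eqxx.
  by rewrite mem_last orbT.
apply/andP; split.
  have := mem_last a sigma; rewrite inE => /predU1P[->|].
    by rewrite -(eqP l) path_lt_le_last.
  rewrite mem_sigma => /orP[/(le_last _ _ p)|/(le_last _ _ p')].
    by rewrite (eqP l).
  by rewrite (eqP l').
move: b_sigma; rewrite inE => /predU1P[->|]; first exact: path_lt_le_last.
exact: le_last.
Qed.

End Partitions.

(** * Sewing *)

Section Sewing.
Context {R : realType} {V : normedModType R}.
Variable Xi : R -> R -> V.

Fixpoint riemann_sum (s : R) (pi : seq R) : V :=
  if pi is u :: pi' then Xi s u + riemann_sum u pi' else 0.

Lemma riemann_sum_cat s pi pi' :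
  riemann_sum s (pi ++ pi') = riemann_sum s pi + riemann_sum (last s pi) pi'.
Proof. by elim: pi s => [|u pi IH] s /=; rewrite ?add0r// IH addrA. Qed.

Variables (lo hi theta C : R).
Hypotheses (theta1 : 1 < theta) (C0 : 0 <= C).
Hypothesis Xi_diag : forall s, lo <= s <= hi -> Xi s s = 0.
Hypothesis Xi_defect : forall s u t, lo <= s -> s <= u -> u <= t -> t <= hi ->
  `|Xi s t - Xi s u - Xi u t| <= C * (t - s) `^ theta.

(** The solution [K] of [2 * (K * 2^-1 `^ theta) + 2 * C = K], which makes the
    induction of [riemann_sum_bound] close up. *)
Definition sewing_const : R := 2 * C / (1 - 2^-1 `^ (theta - 1)).
Local Notation K := sewing_const.

Let theta_gt0 : 0 < theta. Proof. exact: lt_trans theta1. Qed.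
Let theta_ge0 : 0 <= theta. Proof. exact: ltW. Qed.

Lemma half_powR_lt1 : 2^-1 `^ (theta - 1) < 1 :> R.
Proof.
have one : 1 `^ (theta - 1) = 1 :> R by rewrite powR1.
rewrite -[ltRHS]one; apply: gt0_ltr_powR; rewrite ?subr_gt0 ?nnegrE//; lra.
Qed.

Lemma sewing_const_ge0 : 0 <= K.
Proof. by rewrite divr_ge0 ?mulr_ge0// subr_ge0 ltW// half_powR_lt1. Qed.

(** Cutting [pi] at the interval [[v, x]] that crosses the midpoint of [[s, t]]
    leaves two partitions of intervals of length at most [(t - s) / 2].  Their
    errors contribute [2 * K * ((t - s) / 2) `^ theta] by induction, and going
    from [Xi s t] to [Xi s v + Xi v x + Xi x t] costs two defects. *)
Lemma riemann_sum_bound s pi : lo <= s -> path <%R s pi -> last s pi <= hi ->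
  `|riemann_sum s pi - Xi s (last s pi)| <= K * (last s pi - s) `^ theta.
Proof.
have K0 := sewing_const_ge0.
have [n] := ubnP (size pi); elim: n s pi => // n IH s pi pin los; move: pin.
case: pi => [|u0 pi'] pin ppi pihi.
  rewrite /= Xi_diag ?los//= !subrr normr0 mulr_ge0// powR_ge0.
set t := last s (u0 :: pi') in pihi *.
have st : s < t.
  by case/andP: ppi => su /path_lt_le_last; apply: lt_le_trans.
pose m := (s + t) / 2.
have [||l [x [r [pilr /andP[vm mx]]]]] := @path_crossing _ s (u0 :: pi') m.
- by rewrite /m; lra.
- by rewrite -/t /m; lra.
have tE : t = last x r by rewrite /t pilr last_cat.
move: ppi pin; rewrite pilr cat_path /= size_cat /= => /and3P[pl vx pr] pin.
set v := last s l in vm vx.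
have sv : s <= v by exact: path_lt_le_last.
have xt : x <= t by rewrite tE; exact: path_lt_le_last.
have h0 : 0 <= t - s by rewrite subr_ge0 ltW.
have mono z : 0 <= z -> z <= (t - s) / 2 ->
    K * z `^ theta <= K * (t - s) `^ theta * 2^-1 `^ theta.
  move=> z0 zts; rewrite -mulrA -powRM// ?invr_ge0// ler_wpM2l//.
  by apply: ge0_ler_powR; rewrite ?nnegrE ?theta_ge0 ?divr_ge0.
have ln : (size l < n)%N by rewrite -ltnS; apply: leq_ltn_trans pin; rewrite addnS ltnS leq_addr.
have rn : (size r < n)%N by rewrite -ltnS; apply: leq_ltn_trans pin; rewrite addnS ltnS leq_addl.
have left_bound : `|riemann_sum s l - Xi s v| <= K * (v - s) `^ theta.
  apply: IH => //; by rewrite (le_trans (ltW vx))// (le_trans xt).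
have right_bound : `|riemann_sum x r - Xi x t| <= K * (t - x) `^ theta.
  rewrite tE; apply: IH => //; last by rewrite -tE.
  by rewrite (le_trans los)// (le_trans sv)// ltW.
have defect1 := Xi_defect los sv (le_trans (ltW vx) xt) pihi.
have defect2 := Xi_defect (le_trans los sv) (ltW vx) xt pihi.
rewrite riemann_sum_cat /= -/v.
have -> : riemann_sum s l + (Xi v x + riemann_sum x r) - Xi s t =
  (riemann_sum s l - Xi s v) + (riemann_sum x r - Xi x t)
  - (Xi s t - Xi s v - Xi v t) - (Xi v t - Xi v x - Xi x t) by zmod.
have le2 : C * (t - v) `^ theta <= C * (t - s) `^ theta.
  rewrite ler_wpM2l//; apply: ge0_ler_powR; rewrite ?nnegrE ?subr_ge0//.
  - exact: le_trans (ltW vx) xt.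
  - exact: ltW.
  - by rewrite lerB.
have KE : K * (t - s) `^ theta =
    K * (t - s) `^ theta * 2^-1 `^ theta + K * (t - s) `^ theta * 2^-1 `^ theta
    + C * (t - s) `^ theta + C * (t - s) `^ theta.
  have q1 : 1 - 2^-1 `^ (theta - 1) != 0 :> R.
    by rewrite subr_eq0 eq_sym lt_eqF// half_powR_lt1.
  rewrite -(@mulr_powRB1 _ 2^-1 theta) ?invr_ge0//.
  by rewrite /K; field; exact: q1.
rewrite KE (le_trans (ler_normB _ _))// lerD ?(le_trans defect2)//.
rewrite (le_trans (ler_normB _ _))// lerD//.
rewrite (le_trans (ler_normD _ _))// lerD//.
  by rewrite (le_trans left_bound)// mono ?subr_ge0//; move: vm; rewrite /m; lra.
by rewrite (le_trans right_bound)// mono ?subr_ge0//; move: mx; rewrite /m; lra.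
Qed.

(** On each interval of [pi], of length [h < d], the refinement changes the sum
    by at most [K * h `^ theta <= K * d `^ (theta - 1) * h]. *)
Lemma riemann_sum_refine s pi pi' d : lo <= s ->
  path <%R s pi -> path <%R s pi' -> last s pi = last s pi' -> last s pi <= hi ->
  {subset pi <= pi'} -> mesh s pi < d ->
  `|riemann_sum s pi - riemann_sum s pi'| <= K * d `^ (theta - 1) * (last s pi - s).
Proof.
elim: pi s pi' => [|x pi IH] s pi' los.
  case: pi' => [|y pi'] _ ppi' /= lpi' _ _ _; first by rewrite !subrr normr0 mulr0.
  case/andP: ppi' => sy /path_lt_le_last; rewrite -lpi'.
  by move=> /(lt_le_trans sy); rewrite ltxx.
move=> /= /andP[sx px] ppi' lpi pihi sub; rewrite mesh_cons gt_max => /andP[xd md].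
have x_pi' : x \in pi' by rewrite sub// mem_head.
case/splitPr: x_pi' ppi' lpi sub => q1 q2; rewrite cat_path /= last_cat /= => /and3P[pq1 q1x pq2] lpi sub.
have xhi : x <= hi by rewrite (le_trans _ pihi)// path_lt_le_last.
have sub2 : {subset pi <= q2}.
  move=> y ypi; have := sub y; rewrite inE ypi orbT mem_cat inE => /(_ isT).
  have xy : x < y by have /allP := order_path_min lt_trans px; apply.
  rewrite gt_eqF//= => /orP[yq1|//].
  have /splitPr yq := yq1; case: yq pq1 q1x => a b.
  rewrite cat_path last_cat /= => /and3P[_ _ /path_lt_le_last yb] bx.
  by move: (lt_le_trans xy (le_trans yb (ltW bx))); rewrite ltxx.
have := IH x q2 (le_trans los (ltW sx)) px pq2 lpi pihi sub2 md.
have := @riemann_sum_bound s (rcons q1 x) los.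
rewrite rcons_path pq1 last_rcons => /(_ q1x xhi).
rewrite -cats1 !riemann_sum_cat /= addr0.
set A := riemann_sum s q1; set B := riemann_sum x pi; set B' := riemann_sum x q2.
set D := Xi (last s q1) x => coarse rest.
have -> : Xi s x + B - (A + (D + B')) = (B - B') - (A + D - Xi s x) by zmod.
have step : K * (x - s) `^ theta <= K * d `^ (theta - 1) * (x - s).
  have xs0 : 0 <= x - s by rewrite subr_ge0 ltW.
  rewrite -(mulr_powRB1 xs0 theta_gt0).
  rewrite -[leRHS]mulrA ler_wpM2l ?sewing_const_ge0// mulrC.
  rewrite ler_wpM2r//; apply: ge0_ler_powR; rewrite ?nnegrE ?subr_ge0 ?(ltW theta1)//.
  - exact: ltW.
  - exact: le_trans xs0 (ltW xd).
  - exact: ltW.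
have -> : K * d `^ (theta - 1) * (last x pi - s) =
    K * d `^ (theta - 1) * (last x pi - x) + K * d `^ (theta - 1) * (x - s).
  by ring.
by rewrite (le_trans (ler_normB _ _))// lerD// (le_trans coarse).
Qed.

End Sewing.

Section SewingLimit.
Context {R : realType} {V : completeNormedModType R}.
Variable Xi : R -> R -> V.
Variables (lo hi theta C : R).
Hypotheses (theta1 : 1 < theta) (C0 : 0 <= C).
Hypothesis Xi_diag : forall s, lo <= s <= hi -> Xi s s = 0.
Hypothesis Xi_defect : forall s u t, lo <= s -> s <= u -> u <= t -> t <= hi ->
  `|Xi s t - Xi s u - Xi u t| <= C * (t - s) `^ theta.

Local Notation K := (sewing_const theta C).
Local Notation riemann_sum := (riemann_sum Xi).

(** All sums of mesh less than [d] are close to one of them, since any two are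
    compared through a common refinement. *)
Lemma riemann_sum_cvg s t : lo <= s -> s <= t -> t <= hi ->
  cvg (riemann_sum s @ mesh_to_0 s t).
Proof.
move=> los st thi; have FF := mesh_to_0_proper st.
apply: cauchy_cvg; apply: cauchy_exP => e e0.
have K0 := sewing_const_ge0 theta1 C0.
pose c := 2 * (K * (t - s)) + 1.
have c0 : 0 < c by rewrite ltr_pwDr// mulr_ge0// mulr_ge0// subr_ge0.
have theta0 : theta - 1 != 0 by rewrite gt_eqF// subr_gt0.
(* chosen so that [2 * (K * d `^ (theta - 1) * (t - s)) < e] *)
pose d := (e / c) `^ (theta - 1)^-1.
have d0 : 0 < d by rewrite powR_gt0// divr_gt0.
have dE : d `^ (theta - 1) = e / c.
  by rewrite -powRrM mulVf// powRr1// ltW// divr_gt0.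
have [pi0 [pi0P mpi0]] := fine_partition_exists st d0.
exists (riemann_sum s pi0), d => //= pi [piP mpi].
have [sigma [psig /eqP lsig] [sub0 sub]] := common_refinement pi0P piP.
have refine q : itv_partition s t q -> mesh s q < d -> {subset q <= sigma} ->
    `|riemann_sum s q - riemann_sum s sigma| <= K * (e / c) * (t - s).
  move=> [pq /eqP lq] mq subq; rewrite -dE -[in X in _ <= X]lq.
  by apply: (riemann_sum_refine theta1 C0 Xi_diag Xi_defect) => //; rewrite ?lq ?lsig.
rewrite -ball_normE /= -[X in `|X|](subrKA (riemann_sum s sigma)).
rewrite (le_lt_trans (ler_normD _ _))// [X in _ + X]distrC.
apply: le_lt_trans (lerD (refine _ pi0P mpi0 sub0) (refine _ piP mpi sub)) _.
have -> : K * (e / c) * (t - s) + K * (e / c) * (t - s) =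
    (2 * (K * (t - s))) * e / c by ring.
by rewrite ltr_pdivrMr// mulrC ltr_pM2l// /c ltrDl.
Qed.

(** Comparing the limits at [t] and [s] along a partition of [[lo, t]] that
    passes through [s] leaves a Riemann sum over [[s, t]], to which the uniform
    bound [riemann_sum_bound] applies. *)
Lemma sewing s t : lo <= s -> s <= t -> t <= hi ->
  `|lim (riemann_sum lo @ mesh_to_0 lo t) - lim (riemann_sum lo @ mesh_to_0 lo s)
    - Xi s t| <= K * (t - s) `^ theta.
Proof.
move=> los st thi; apply/ler_addgt0Pr => e e0.
have e20 : 0 < e / 2 by rewrite divr_gt0.
have close r : lo <= r -> r <= hi -> exists2 d, 0 < d & forall pi,
    itv_partition lo r pi -> mesh lo pi < d ->
    `|lim (riemann_sum lo @ mesh_to_0 lo r) - riemann_sum lo pi| <= e / 2.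
  move=> lor rhi; have FF := mesh_to_0_proper lor.
  have /cvgrPdist_le /(_ _ e20) [d /= d0 Hd] := riemann_sum_cvg (lexx lo) lor rhi.
  by exists d => // pi piP mpi; apply: Hd.
have [d1 d10 H1] := close s los (le_trans st thi).
have [d2 d20 H2] := close t (le_trans los st) thi.
have d0 : 0 < Num.min d1 d2 by rewrite lt_min d10.
have [pi [piP]] := fine_partition_exists los d0; rewrite lt_min => /andP[mpi1 mpi2].
have [pi' [[ppi' /eqP lpi']]] := fine_partition_exists st d0.
rewrite lt_min => /andP[_ mpi'].
have {}H1 := H1 _ piP mpi1; case: piP => ppi /eqP lpi.
have {}H2 : `|lim (riemann_sum lo @ mesh_to_0 lo t) -
    riemann_sum lo (pi ++ pi')| <= e / 2.
  apply: H2; last by rewrite mesh_cat_lt lpi mpi2.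
  by split; rewrite ?cat_path ?last_cat lpi ?ppi ?lpi'.
have := riemann_sum_bound theta1 C0 Xi_diag Xi_defect los ppi'; rewrite lpi' => /(_ thi) H3.
move: H1 H2; rewrite riemann_sum_cat lpi.
set Is := lim _; set It := lim _; set P := riemann_sum lo pi => H1 H2.
have -> : It - Is - Xi s t =
  (riemann_sum s pi' - Xi s t) + (It - (P + riemann_sum s pi') - (Is - P)) by zmod.
rewrite (le_trans (ler_normD _ _))// lerD// (le_trans (ler_normB _ _))//.
by rewrite (splitr e) lerD.
Qed.

End SewingLimit.

(** * The rough integral is controlled *)

Lemma rough_sumE {R : realType} {V : normedModType R} (W : R -> V -> V)
    (WW : R -> R -> V -> V -> V) (Y Yd : R -> V) (a : R) (pi : seq R) :
  rough_sum W WW Y Yd a pi = riemann_sum (germ W WW Y Yd) a pi.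
Proof.
elim: pi a => [|u pi IH] a; first by rewrite /rough_sum big_ord0.
rewrite /= -IH /rough_sum big_ord_recl; congr (_ + _).
by apply: eq_bigr => i _; rewrite lift0 !partition_pt_cons// ltnW.
Qed.

Unset Implicit Arguments.

Theorem proposition3p12 (R : realType) (V : completeNormedModType R)
    (V_separable : separable_space V) (T alpha : R)
    (T_gt0 : 0 < T) (alpha_gt : 3^-1 < alpha) (alpha_le : alpha <= 2^-1)
    (beta : 'I_3 -> R) (beta_ge0 : forall k, 0 <= beta k)
    (W : R -> V -> V) (WW : R -> R -> V -> V -> V)
    (rough_W : nonlinear_rough_path T alpha beta W WW)
    (Y Yd : R -> V) (controlled_Y : controlled T alpha W Y Yd)
    (Z : R -> V)
    (Z_integral : forall t, t \in `[0, T] ->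
      Z t = rough_integral W WW Y Yd 0 t) :
  controlled T alpha W Z Y.
Proof.
have alpha0 : 0 < alpha by apply: lt_trans alpha_gt; rewrite invr_gt0.
have theta1 : 1 < 3 * alpha by rewrite -ltr_pdivrMl// mulr1.
have [hY hYd _] := controlled_Y.
have [C C0 defect] := germ_defect T_gt0 rough_W alpha0 controlled_Y.
have diag s : 0 <= s <= T -> germ W WW Y Yd s s = 0.
  by move=> sT; apply: (germ_diag rough_W); rewrite in_itv.
have sew := sewing theta1 C0 diag defect.
have {}sew s t : s \in `[0, T] -> t \in `[0, T] -> s <= t ->
    `|Z t - Z s - germ W WW Y Yd s t| <=
       sewing_const (3 * alpha) C * (t - s) `^ (3 * alpha).
  move=> sI tI st; have [/andP[s0 _] /andP[_ tT]] := (sI, tI).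
  rewrite (Z_integral t tI) (Z_integral s sI) /rough_integral.
  have -> : rough_sum W WW Y Yd 0 = riemann_sum (germ W WW Y Yd) 0.
    by apply/funext => pi; exact: rough_sumE.
  exact: sew.
have K0 := sewing_const_ge0 theta1 C0.
set K := sewing_const _ _ in sew K0.
have [M1 M10 YM1] := holder_bounded T_gt0 (ltW alpha0) hY.
have [M2 M20 YdM2] := holder_bounded T_gt0 (ltW alpha0) hYd.
have M0 : 0 <= M1 + M2 by exact: addr_ge0.
have YM r : r \in `[0, T] -> `|Y r| <= M1 + M2.
  by move=> rT; rewrite (le_trans (YM1 r rT))// lerDl.
have YdM r : r \in `[0, T] -> `|Yd r| <= M1 + M2.
  by move=> rT; rewrite (le_trans (YdM2 r rT))// lerDr.
have [L L0 WL] := rough_path_local_bounds T_gt0 rough_W M0.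
have [CY CY0 YC] := (holder2P T_gt0 _ _).1 hY.
pose A := K * T `^ alpha + L.
have A0 : 0 <= A by rewrite addr_ge0// mulr_ge0// powR_ge0.
have p_le s t : s \in `[0, T] -> t \in `[0, T] -> `|t - s| `^ alpha <= T `^ alpha.
  rewrite !in_itv/= => /andP[s0 sT] /andP[t0 tT].
  apply: ge0_ler_powR; rewrite ?nnegrE ?(ltW alpha0) ?(ltW T_gt0)//.
  by rewrite ler_norml; apply/andP; split; lra.
(* For [s < t] the bound is read off the germ; the case [s > t] is reduced to it
   by exchanging the times, which moves the base point of [W_{t,s}] from [Y_s]
   to [Y_t] at the cost of its Lipschitz bound. *)
have fwd s t : s \in `[0, T] -> t \in `[0, T] -> s < t ->
    `|Z t - Z s - (W t (Y s) - W s (Y s))| <= A * (`|t - s| `^ alpha) ^+ 2.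
  move=> sI tI st.
  have /(WL s t sI tI)[_ [Wb _]] : s != t by rewrite lt_eqF.
  have [_ _] := Wb (Yd s) (Y s) (YdM s sI) (YM s sI).
  rewrite powR_natl_mul => WWb.
  have sewst := sew s t sI tI (ltW st).
  have ts : t - s = `|t - s| by rewrite gtr0_norm// subr_gt0.
  rewrite {}ts powR_natl_mul in sewst.
  have -> : Z t - Z s - (W t (Y s) - W s (Y s)) =
    (Z t - Z s - germ W WW Y Yd s t) + WW s t (Yd s) (Y s).
    by rewrite /germ; zmod.
  rewrite (le_trans (ler_normD _ _))// /A mulrDl lerD//.
  rewrite (le_trans sewst)// exprS mulrA ler_wpM2r ?exprn_ge0 ?powR_ge0//.
  by rewrite ler_wpM2l// p_le.
have rem s t : s \in `[0, T] -> t \in `[0, T] -> s != t ->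
    `|Z t - Z s - (W t (Y s) - W s (Y s))| <=
      (A + L * CY) * (`|t - s| `^ alpha) ^+ 2.
  move=> sI tI; rewrite neq_lt => /orP[st|ts].
    rewrite (le_trans (fwd s t sI tI st))// ler_wpM2r ?exprn_ge0 ?powR_ge0//.
    by rewrite lerDl mulr_ge0.
  have nts : t != s by rewrite lt_eqF.
  have [_ [Wb _]] := WL t s tI sI nts.
  have [Wlip _ _] := Wb (Y t) (Y s) (YM t tI) (YM s sI).
  have -> : Z t - Z s - (W t (Y s) - W s (Y s)) =
    (W s (Y s) - W t (Y s) - (W s (Y t) - W t (Y t)))
    - (Z s - Z t - (W s (Y t) - W t (Y t))) by zmod.
  rewrite [`|t - s|]distrC (le_trans (ler_normB _ _))// addrC mulrDl lerD ?fwd//.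
  rewrite (le_trans Wlip)//.
  have -> : L * CY * (`|s - t| `^ alpha) ^+ 2 =
    L * `|s - t| `^ alpha * (CY * `|s - t| `^ alpha) by ring.
  by rewrite ler_wpM2l ?mulr_ge0 ?powR_ge0// YC.
have ALC0 : 0 <= A + L * CY by rewrite addr_ge0// mulr_ge0.
split=> //; apply/(holder2P T_gt0); last first.
  exists (A + L * CY) => // s t sI tI st.
  by rewrite powR_natl_mul rem.
(* [Z] is Hoelder because its remainder and [W_{s,t}(Y_s)] are. *)
exists ((A + L * CY) * T `^ alpha + L).
  by rewrite addr_ge0// mulr_ge0// powR_ge0.
move=> s t sI tI st.
have [/(_ _ (YM s sI))[Wb _] _] := WL s t sI tI st.
rewrite -(subrK (W t (Y s) - W s (Y s)) (Z t - Z s)).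
rewrite (le_trans (ler_normD _ _))// mulrDl lerD//.
rewrite (le_trans (rem s t sI tI st))// expr2 mulrA.
by rewrite ler_wpM2r ?powR_ge0// ler_wpM2l// p_le.
Qed.
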